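(* Let $\phi = \frac{1+\sqrt{5}}{2}$. The Long Game Strategy takes at least $$\frac{n^2}{2} - n\log_\phi(n) + o(n\log_\phi(n))$$ moves as $n \to \infty$; that is, there is a function $e(n)$ with $e(n)/(n\log_\phi n) \to 0$ as $n \to \infty$ such that, for every integer $n \ge 2$, every play of the ordered Zeckendorf game on $n$ in which all moves follow the Long Game Strategy has length at least $\frac{n^2}{2} - n\log_\phi(n) + e(n)$.
   Context: The Fibonacci numbers are indexed by $F_1 = 1$, $F_2 = 2$, and $F_{i+1} = F_i + F_{i-1}$ for $i \ge 2$. The (two-player) ordered Zeckendorf game on $n$: a state is a finite ordered list (tuple) of Fibonacci numbers. The initial state is the list $(F_1, F_1, \dots, F_1)$ of $n$ copies of $F_1$. Players alternate turns; on each turn the player performs one of the following legal moves on two adjacent entries of the list (the other entries and their order being unchanged): (1) Merging: replace an adjacent pair $(F_i, F_{i+1})$ with the single entry $F_{i+2}$. (2) Merging ones: replace an adjacent pair $(F_1, F_1)$ with the single entry $F_2$. (3) Splitting: replace an adjacent pair $(F_i, F_i)$ with $(F_{i-2}, F_{i+1})$, for $i > 2$. (4) Splitting twos: replace an adjacent pair $(F_2, F_2)$ with $(F_1, F_3)$. (5) Switching: replace an adjacent pair $(F_i, F_j)$ with $(F_j, F_i)$ whenever $i > j$. The game ends when no legal move can be applied. The length of a play is the total number of moves made (by both players together) until the game ends. The Long Game Strategy (LGS) is the following priority-based strategy, followed at every turn: perform a move of the first type in this list for which a move is available: (i) a switch move (any available one; the order of switches is arbitrary); (ii) merge adjacent ones,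 choosing the leftmost available pair $(F_1, F_1)$; (iii) a split move (splitting or splitting twos), choosing the rightmost available pair; (iv) a merge move $(F_i, F_{i+1}) \to F_{i+2}$, choosing the leftmost available pair. *)

(* Defs.v *)
From HB Require Import structures.
From mathcomp Require Import all_boot all_order all_algebra.
From mathcomp Require Import all_classical all_reals all_analysis.

Set Implicit Arguments.
Unset Strict Implicit.
Unset Printing Implicit Defensive.

Import Order.TTheory GRing.Theory Num.Theory.
Import numFieldNormedType.Exports.

Local Open Scope nat_scope.

(* Fibonacci numbers with F_1 = 1, F_2 = 2. The value at 0 only seeds the
   recursion: every rule below mentions F_i with i >= 1 only. *)
Fixpoint fib (i : nat) : nat :=
  match i with
  | 0 => 1
  | 1 => 1
  | (j.+1 as k).+1 => fib k + fib j
  end.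

(* A state lists the Fibonacci numbers themselves, not their indices. *)
Definition state := seq nat.

Definition initial_state (n : nat) : state := nseq n (fib 1).

(* [r x y w]: the adjacent pair (x, y) may be replaced with the block w. *)
Definition rule := nat -> nat -> seq nat -> Prop.

Inductive merge_rule : rule :=
  | Merge i : 0 < i -> merge_rule (fib i) (fib i.+1) [:: fib i.+2].

Inductive merge_ones_rule : rule :=
  | MergeOnes : merge_ones_rule (fib 1) (fib 1) [:: fib 2].

Inductive split_rule : rule :=
  | Split i : 2 < i -> split_rule (fib i) (fib i) [:: fib (i - 2); fib i.+1].

Inductive split_twos_rule : rule :=
  | SplitTwos : split_twos_rule (fib 2) (fib 2) [:: fib 1; fib 3].

Inductive switch_rule : rule :=
  | Switch i j : 0 < j -> j < i -> switch_rule (fib i) (fib j) [:: fib j; fib i].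

Definition any_split_rule : rule :=
  fun x y w => split_rule x y w \/ split_twos_rule x y w.

Definition legal_rule : rule :=
  fun x y w => [\/ merge_rule x y w, merge_ones_rule x y w, any_split_rule x y w
                 | switch_rule x y w].

(* [move_at r k s t]: t results from s by rule r on the entries k and k + 1,
   counted from the left and from 0. *)
Definition move_at (r : rule) (k : nat) (s t : state) : Prop :=
  exists u v x y w,
    [/\ size u = k, s = u ++ [:: x; y] ++ v, r x y w & t = u ++ w ++ v].

Definition available_at (r : rule) (s : state) (k : nat) : Prop :=
  exists t, move_at r k s t.

Definition available (r : rule) (s : state) : Prop :=
  exists k, available_at r s k.

Definition any_move (r : rule) (s t : state) : Prop :=
  exists k, move_at r k s t.

Definition leftmost_move (r : rule) (s t : state) : Prop :=
  exists2 k, move_at r k s t & forall j, available_at r s j -> k <= j.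

Definition rightmost_move (r : rule) (s t : state) : Prop :=
  exists2 k, move_at r k s t & forall j, available_at r s j -> j <= k.

Definition game_over (s : state) : Prop := ~ available legal_rule s.

Definition lgs_move (s t : state) : Prop :=
  [\/ any_move switch_rule s t,
      ~ available switch_rule s /\ leftmost_move merge_ones_rule s t,
      [/\ ~ available switch_rule s, ~ available merge_ones_rule s
        & rightmost_move any_split_rule s t]
    | [/\ ~ available switch_rule s, ~ available merge_ones_rule s,
          ~ available any_split_rule s & leftmost_move merge_rule s t]].

(* [plays step s p]: p lists the states reached, one per move, from s. *)
Fixpoint plays (step : state -> state -> Prop) (s : state) (p : seq state) :
    Prop :=
  if p is t :: p' then step s t /\ plays step t p' else True.

(* A complete play on n of the game in which both players follow the Long Game
   Strategy; its length is [size p], as the initial state is not listed. *)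
Definition lgs_play (n : nat) (p : seq state) : Prop :=
  plays lgs_move (initial_state n) p /\ game_over (last (initial_state n) p).

Local Open Scope ring_scope.

Definition golden_ratio (R : realType) : R := (1 + Num.sqrt 5%:R) / 2%:R.

Definition log_phi (R : realType) (x : R) : R := ln x / ln (golden_ratio R).

(* Main.v *)
Require Import Defs.
From HB Require Import structures.
From mathcomp Require Import all_boot all_order all_algebra.
From mathcomp Require Import all_classical all_reals all_analysis.
From mathcomp Require Import zify ring lra.
Import Order.TTheory GRing.Theory Num.Theory.
Import numFieldNormedType.Exports.
Local Open Scope classical_set_scope.

(** Under the Long Game Strategy all switches are made before anything else,
so every other move is made on a weakly increasing list, which is determined
by the numbers c_i of its entries F_i.  A move made on a sorted list is
followed by exactly as many switches as it creates inversions, and these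
switches make up almost the whole game.

Give each entry F_1 the weight 1 and every other entry the weight 2, and let V
be the total weight.  Merging ones keeps V.  So does splitting F_i, F_i for
i > 3, while splitting two F_2 or two F_3 lowers V by exactly 1, and sends a
new F_1 to the left across nearly all the entries F_2.  Suppose that at most
M - 2 entries exceed F_2 at all times.  Then c_2 is at least about (V - 2M)/2
when this happens, which is by how much (V - 2M)^2 / 4 decreases.  Merging
ones takes c_1 to c_1 - 2 and creates c_1 - 2 inversions, which together with
the merge itself pays for the decrease of c_1^2 / 4.  Hence, I being the
number of inversions and the difference being truncated at 0,
<<
  I + c_1^2 / 4 + (V - 2M)^2 / 4
>>
loses at most 1 at each move ([lgs_step]).  It starts at
n^2 / 4 + (n - 2M)^2 / 4 and ends at no more than 1/4, so that the game has at
least n^2 / 2 - n M - 1/4 moves ([lgs_play_size]).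

It remains to see that M can be taken to be log_phi n + O(1).  At any time at
most one Fibonacci number beyond F_2 occurs twice, the others at most once:
doubled entries are resolved like a carry in the addition of 1 to a
Fibonacci-base numeral.  For this to be stable, the two indices below the
doubled one must be vacant ([sparse]).  Thus the number of entries beyond F_2
is at most one more than the number of such F_i up to n, and F_i grows like
phi^i. *)

Local Open Scope nat_scope.

(** * Fibonacci numbers *)

Lemma fibSS i : fib i.+2 = fib i.+1 + fib i. Proof. by []. Qed.

Lemma fib_gt0 i : 0 < fib i.
Proof.
suff: 0 < fib i /\ 0 < fib i.+1 by case.
by elim: i => [//|i [IH1 IH2]]; split=> //; rewrite fibSS; lia.
Qed.

Lemma ltn_fib i j : 0 < i -> i < j -> fib i < fib j.
Proof.
move=> i_gt0; elim: j => // j IHj; rewrite ltnS => le_ij.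
have lt_fibS : fib j < fib j.+1.
  by case: j le_ij {IHj} => [|j] le_ij; [lia|have := fib_gt0 j; rewrite fibSS; lia].
case: (ltngtP i j) le_ij => // [lt_ij|->] _ //.
exact: ltn_trans (IHj lt_ij) lt_fibS.
Qed.

Lemma eq_fib i j : 0 < i -> 0 < j -> (fib i == fib j) = (i == j).
Proof.
move=> i_gt0 j_gt0; have [lt_ij|lt_ji|->] := ltngtP i j; last by rewrite eqxx.
- by have := ltn_fib _ _ i_gt0 lt_ij; lia.
- by have := ltn_fib _ _ j_gt0 lt_ji; lia.
Qed.

Lemma fib_split i : 2 < i -> fib i + fib i = fib (i - 2) + fib i.+1.
Proof.
case: i => [|[|i]] // _; rewrite subn2 /= .
have := fibSS i; have := fibSS i.+1; rewrite /=; lia.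
Qed.

Lemma leq_fib_index i : i <= fib i.
Proof.
elim: i => // -[//|i] IHi; rewrite fibSS.
by have := fib_gt0 i; lia.
Qed.

(** * Inversions and sorted states *)

Fixpoint inversions (s : seq nat) : nat :=
  if s is x :: s' then count (ltn^~ x) s' + inversions s' else 0.

(** Every switch removes exactly one inversion, so the number of switches up to
the next sorted state does not depend on their order. *)
Lemma inversions_switch u x y v : y < x ->
  inversions (u ++ [:: x; y] ++ v) = (inversions (u ++ [:: y; x] ++ v)).+1.
Proof.
move=> lt_yx; elim: u => [|z u IHu] /=; first by lia.
by rewrite IHu !count_cat /=; lia.
Qed.

Lemma sorted_inversions s : sorted leq s -> inversions s = 0.
Proof.
elim: s => //= x s IHs x_s; rewrite IHs ?(path_sorted x_s) // addn0.
apply/eqP; rewrite -leqn0 leqNgt -has_count; apply/hasPn => y.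
by move/(allP (order_path_min leq_trans x_s)); rewrite -leqNgt.
Qed.

(** The cost of inserting [y] far to the right: this counts the switches that
bring the lower half of a split back to its place. *)
Lemma leq_inversions u y v : count (fun x => y < x) u <= inversions (u ++ y :: v).
Proof. by elim: u => //= x u IHu; rewrite count_cat /=; lia. Qed.

Definition number_of (i : nat) (s : state) : nat := count_mem (fib i) s.

Definition fib_entries (s : state) : Prop :=
  forall x, x \in s -> exists2 i, 0 < i & x = fib i.

Lemma number_of2 i u a b v : 0 < i -> 0 < a -> 0 < b ->
  number_of i (u ++ [:: fib a; fib b] ++ v)
    = number_of i u + (a == i) + (b == i) + number_of i v.
Proof.
by move=> i0 a0 b0; rewrite /number_of !count_cat /= !eq_fib //; lia.
Qed.

Lemma number_of1 i u a v : 0 < i -> 0 < a ->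
  number_of i (u ++ [:: fib a] ++ v)
    = number_of i u + (a == i) + number_of i v.
Proof.
by move=> i0 a0; rewrite /number_of !count_cat /= !eq_fib //; lia.
Qed.

Lemma available_pair (r : rule) u x y v w :
  r x y w -> available_at r (u ++ [:: x; y] ++ v) (size u).
Proof. by move=> rw; exists (u ++ w ++ v); exists u, v, x, y, w. Qed.

(** The entries being Fibonacci numbers of positive index, every descent is a
switch, so the moves other than switches are made on sorted states. *)
Lemma no_switch_sorted s :
  fib_entries s -> ~ available switch_rule s -> sorted leq s.
Proof.
move=> fs nsw; apply/(sortedP 0) => k lt_ks; rewrite leqNgt; apply/negP => lt.
have [i i_gt0 Ei] := fs _ (mem_nth 0 (ltnW lt_ks)).
have [j j_gt0 Ej] := fs _ (mem_nth 0 lt_ks).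
apply: nsw; exists (size (take k s)).
rewrite -{1}(cat_take_drop k s) (drop_nth 0 (ltnW lt_ks)) (drop_nth 0 lt_ks).
apply: (available_pair _ _ _ _ (drop k.+2 s) [:: fib j; fib i]).
rewrite Ei Ej; constructor=> //; rewrite ltnNge leq_eqVlt; apply/negP.
case/orP=> [/eqP ij|ij]; move: lt; rewrite Ei Ej ?ij ?ltnn //.
by have := ltn_fib _ _ i_gt0 ij; lia.
Qed.

(** In a sorted state equal entries are adjacent, hence repetitions show up as
available moves. *)
Lemma sorted_repeated s x : sorted leq s -> 1 < count_mem x s ->
  exists u v, s = u ++ [:: x; x] ++ v.
Proof.
elim: s => //= y s IHs; have [->|yx] := eqVneq y x; last first.
  by move=> y_s /(IHs (path_sorted y_s))[u [v ->]]; exists (y :: u), v.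
rewrite add1n ltnS => x_s x_in_s; exists [::].
case: s x_s x_in_s {IHs} => //= z s /andP[le_xz z_s].
have [->|zx] := eqVneq z x; first by exists s.
rewrite -has_count has_pred1 => x_in.
by have := allP (order_path_min leq_trans z_s) _ x_in; move=> /= le_zx; lia.
Qed.

Lemma count_cat_pair (a : pred nat) u x y v :
  count a (u ++ [:: x; y] ++ v) = count a u + a x + a y + count a v.
Proof. by rewrite !count_cat /=; lia. Qed.

(** * The carry invariant *)

(** The two vacant indices below a doubled F_i are what makes the invariant
stable: splitting F_i, F_i adds one to c_(i-2), which was 0, empties index i,
and can at most double F_(i+1), below which i and i - 1 are then vacant.  The
boolean [j < i <= j + 2] counts as 0 or 1: it lowers the bound on c_j from 1
to 0 for j = i - 1 and j = i - 2.  Indices 1 and 2 are unconstrained. *)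
Definition sparse (s : state) : Prop :=
  forall i, 2 < i -> number_of i s <= 2 /\
    forall j, 2 < j -> j != i -> number_of i s = 2 ->
      number_of j s + (j < i <= j + 2) <= 1.

Lemma sparse_merge_ones u v :
  sparse (u ++ [:: fib 1; fib 1] ++ v) -> sparse (u ++ [:: fib 2] ++ v).
Proof.
move=> sp i i_gt2; have [] := sp i i_gt2.
rewrite number_of2 ?number_of1 //; try lia.
move=> le2 sp_i; split=> [|j j_gt2 ji]; first lia.
have := sp_i j j_gt2 ji; rewrite number_of2 ?number_of1 //; lia.
Qed.

Lemma sparse_split u v i : 2 < i -> sparse (u ++ [:: fib i; fib i] ++ v) ->
  sparse (u ++ [:: fib (i - 2); fib i.+1] ++ v).
Proof.
move=> i_gt2 sp; have [Ei2 spi] := sp i i_gt2.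
move: Ei2 spi; rewrite number_of2 ?eqxx; try lia.
move=> Ei2 spi k k_gt2.
have spk : k != i -> number_of k u + number_of k v + (k < i <= k + 2) <= 1.
  move=> ki; have := spi k k_gt2 ki.
  by rewrite number_of2; lia.
split=> [|j j_gt2 jk].
  by rewrite number_of2; try lia; have [?|/spk] := eqVneq k i; [subst k|]; lia.
have spj : j != i -> number_of j u + number_of j v + (j < i <= j + 2) <= 1.
  move=> ji; have := spi j j_gt2 ji.
  by rewrite number_of2; lia.
rewrite !number_of2; try lia.
have [->|ki] := eqVneq k i; first by lia.
have := spk ki; have [->|ji] := eqVneq j i; first by lia.
by have := spj ji; lia.
Qed.

Lemma sparse_split_twos u v :
  (forall i, 2 < i -> number_of i (u ++ [:: fib 2; fib 2] ++ v) <= 1) ->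
  sparse (u ++ [:: fib 1; fib 3] ++ v).
Proof.
move=> le1 i i_gt2; have := le1 i i_gt2; rewrite !number_of2; try lia.
move=> le1i; split=> [|j j_gt2 ji]; first lia.
by have := le1 j j_gt2; rewrite !number_of2; lia.
Qed.

Lemma sparse_merge u v i : 0 < i ->
  (forall j, 2 < j -> number_of j (u ++ [:: fib i; fib i.+1] ++ v) <= 1) ->
  sparse (u ++ [:: fib i.+2] ++ v).
Proof.
move=> i_gt0 le1 k k_gt2; have := le1 k k_gt2; rewrite number_of2 ?number_of1; try lia.
move=> le1k; split=> [|j j_gt2 jk]; first lia.
by have := le1 j j_gt2; rewrite number_of2 ?number_of1; lia.
Qed.

(** * Few entries exceed F_2 *)

Lemma sum_single_two (c : nat -> nat) (m n : nat) :
  (forall i, m <= i < n -> c i <= 2) ->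
  (forall i j, m <= i < n -> m <= j < n -> j != i -> c i = 2 -> c j <= 1) ->
  \sum_(m <= i < n) c i <= (n - m).+1.
Proof.
have [le_nm _ _|lt_mn] := leqP n m; first by rewrite big_geq.
rewrite -(subnKC (ltnW lt_mn)); move: (n - m) => d {n lt_mn}.
elim: d => [_ _|d IHd le2 uniq2]; first by rewrite addn0 big_geq.
rewrite addnS big_nat_recr ?leq_addr //=.
have [le1|gt1] := leqP (c (m + d)) 1.
  suff : \sum_(m <= i < m + d) c i <= (m + d - m).+1 by lia.
  by apply: IHd => [i im|i j im jm]; [apply: le2|apply: uniq2]; lia.
have c2 : c (m + d) = 2 by have := le2 (m + d); lia.
suff : \sum_(m <= i < m + d) c i <= \sum_(m <= i < m + d) 1.
  by rewrite c2 sum_nat_const_nat; lia.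
rewrite !big_nat; apply: leq_sum => i im; apply: (uniq2 (m + d)); lia.
Qed.

Lemma count_large K s : fib_entries s ->
  (forall i, 0 < i -> fib i \in s -> i <= K) ->
  count (ltn 2) s = \sum_(3 <= i < K.+1) number_of i s.
Proof.
elim: s => [|x s IHs] fs leK /=; first by rewrite big1.
rewrite /number_of /= big_split /= -IHs; first last.
- by move=> i i_gt0 i_s; apply: leK => //; rewrite inE i_s orbT.
- by move=> y y_s; apply: fs; rewrite inE y_s orbT.
congr (_ + _); have [k k_gt0 Ex] := fs x (mem_head x s).
have le_kK : k <= K by apply: leK => //; rewrite Ex mem_head.
rewrite {}Ex (eq_big_nat _ _ (F2 := fun i => nat_of_bool (i == k))); last first.
  by move=> i i_gt2; rewrite eq_fib //; lia.
have -> : (2 < fib k) = (k \in index_iota 3 K.+1).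
  rewrite mem_index_iota; case: k k_gt0 le_kK => [|[|[|k]]] // _ le_kK.
  by have := leq_fib_index k.+3; lia.
rewrite -count_uniq_mem ?iota_uniq // -sum1_count big_mkcond /=.
by apply: eq_bigr => i _; case: eqP.
Qed.

(** By the carry invariant the K - 2 values F_3, ..., F_K account for at most
K - 1 entries, one value being possibly doubled. *)
Lemma count_large_le K s : 1 < K -> fib_entries s -> sparse s ->
  (forall i, 0 < i -> fib i \in s -> i <= K) -> count (ltn 2) s < K.
Proof.
move=> K_gt1 fs sp leK; rewrite (count_large K) //.
suff : \sum_(3 <= i < K.+1) number_of i s <= (K.+1 - 3).+1 by lia.
apply: sum_single_two => [i im|i j im jm ji ci2]; first by have [] := sp i; lia.
by have [|_ /(_ j)] := sp i; lia.
Qed.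

Lemma size_by_value s : fib_entries s ->
  size s = number_of 1 s + number_of 2 s + count (ltn 2) s.
Proof.
elim: s => // x s IHs fs; rewrite /= IHs => [|y ys]; last first.
  by apply: fs; rewrite inE ys orbT.
have [i _ ->] := fs x (mem_head x s); have := fib_gt0 i.
rewrite /number_of /=; lia.
Qed.

(** * What the priorities of the strategy imply *)

Lemma any_split_fib i : 1 < i -> exists w, any_split_rule (fib i) (fib i) w.
Proof.
move=> i_gt1; have [i_gt2|i_le2] := ltnP 2 i.
  by exists [:: fib (i - 2); fib i.+1]; left; exact: Defs.Split.
have -> : i = 2 by lia.
by exists [:: fib 1; fib 3]; right; exact: SplitTwos.
Qed.

Lemma available_any_split s i : sorted leq s -> 1 < i -> 1 < number_of i s ->
  available any_split_rule s.
Proof.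
move=> s_s i_gt1 /(sorted_repeated _ _ s_s)[u [v ->]]; exists (size u).
have [w rw] := any_split_fib _ i_gt1; exact: available_pair rw.
Qed.

Lemma available_merge_ones s : sorted leq s -> 1 < number_of 1 s ->
  available merge_ones_rule s.
Proof.
move=> s_s /(sorted_repeated _ _ s_s)[u [v ->]]; exists (size u).
exact: available_pair MergeOnes.
Qed.

(** All the entries before a pair of ones in a sorted state are ones, so the
leftmost pair is at the very start, and the new F_2 has to cross all the
remaining ones. *)
Lemma leftmost_ones u v : fib_entries (u ++ [:: fib 1; fib 1] ++ v) ->
  sorted leq (u ++ [:: fib 1; fib 1] ++ v) ->
  (forall j, available_at merge_ones_rule (u ++ [:: fib 1; fib 1] ++ v) j ->
     size u <= j) -> u = [::].
Proof.
move=> fs s_s left_u.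
have u1 : u = nseq (size u) (fib 1).
  apply/all_pred1P/allP => x x_u /=.
  have [i i_gt0 Ex] : exists2 i, 0 < i & x = fib i by apply: fs; rewrite mem_cat x_u.
  have : x <= fib 1.
    move: s_s; rewrite sorted_pairwise; last exact: leq_trans.
    by rewrite pairwise_cat => /andP[/allrelP/(_ x (fib 1) x_u)-> //].
  by have := fib_gt0 i; rewrite -Ex /=; lia.
case: {fs s_s} u u1 left_u => // x u [-> ->] /(_ 0) /=.
rewrite ltn0 => H; exfalso; suff: false by []. apply: H.
case: (size u) => [|k] /=.
  exact: (available_pair _ [::] _ _ (fib 1 :: v) _ MergeOnes).
exact: (available_pair _ [::] _ _ (nseq k _ ++ _) _ MergeOnes).
Qed.

(** From the pair split on, no entry is repeated: it would give a split further
to the right.  For a split of twos this means that the new F_1 has to cross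
all the remaining twos, and that no larger entry is doubled. *)
Lemma rightmost_split u v i j :
  let s := u ++ [:: fib i; fib i] ++ v in
  sorted leq s -> 1 < j ->
  (forall k, available_at any_split_rule s k -> k <= size u) ->
  number_of j (fib i :: v) <= 1.
Proof.
move=> s s_s j_gt1 right_u; rewrite leqNgt; apply/negP => j2.
have v_s : sorted leq (fib i :: v).
  by move: s_s => /cat_sorted2[_] /= /andP[].
have [u' [v' Ev]] := sorted_repeated _ _ v_s j2.
have Es : s = (u ++ fib i :: u') ++ [:: fib j; fib j] ++ v'.
  by rewrite /s -catA /= -Ev.
suff /right_u : available_at any_split_rule s (size (u ++ fib i :: u')).
  by rewrite size_cat /=; lia.
rewrite Es; have [w rw] := any_split_fib _ j_gt1; exact: available_pair rw.
Qed.

(** * The potential *)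

(** Four times the potential described above, with M = K + 1.  The weight V is
[2 * size s - number_of 1 s], and the subtraction of 2M is truncated. *)
Definition potential (K : nat) (s : state) : nat :=
  4 * inversions s + number_of 1 s ^ 2
    + (2 * size s - number_of 1 s - 2 * K.+1) ^ 2.

(** The weight V is unchanged and c_1^2 - (c_1 - 2)^2 = 4 (c_1 - 2) + 4: the
c_1 - 2 inversions and the move itself pay for this exactly. *)
Lemma potential_merge_ones K v :
  sorted leq ([:: fib 1; fib 1] ++ v) -> fib_entries v ->
  potential K ([:: fib 1; fib 1] ++ v) <= potential K ([:: fib 2] ++ v) + 4.
Proof.
move=> s_s fv; rewrite /potential (sorted_inversions _ s_s).
rewrite (number_of2 1 [::]) // (number_of1 1 [::]) // !size_cat /=.
suff le_ones : number_of 1 v <= count (ltn^~ (fib 2)) v.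
  have -> : 2 * (2 + size v) - (0 + true + true + number_of 1 v)
         = 2 * (1 + size v) - (0 + false + number_of 1 v) by lia.
  rewrite /number_of /= in le_ones *; nia.
by apply: sub_count => x /= /eqP ->.
Qed.

(** Here [x] is F_2 or F_3: these are the splits that produce an F_1, and so
lower V by 1.  With A = V - 2M the potential loses at most 2A - 1, and the
bound on the size gives A <= 2 c_2 - 2, whereas at least c_2 - 2 inversions
are created. *)
Lemma potential_split K u v x a :
  0 < a -> sorted leq (u ++ [:: x; x] ++ v) ->
  number_of 1 (u ++ [:: x; x] ++ v) <= 1 ->
  size (u ++ [:: x; x] ++ v) < number_of 1 (u ++ [:: x; x] ++ v)
    + number_of 2 (u ++ [:: x; x] ++ v) + K ->
  1 < x ->
  number_of 2 (u ++ [:: x; x] ++ v) <= (count (ltn (fib 1)) u).+2 ->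
  potential K (u ++ [:: x; x] ++ v)
    <= potential K (u ++ [:: fib 1; fib a.+1] ++ v) + 4.
Proof.
move=> a_gt0 s_s ones large x_gt1 twos.
have inv_t := leq_inversions u (fib 1) (fib a.+1 :: v).
have c1 : number_of 1 (u ++ [:: fib 1; fib a.+1] ++ v)
    = (number_of 1 (u ++ [:: x; x] ++ v)).+1.
  rewrite number_of2 //; rewrite /number_of !count_cat /=; lia.
rewrite /potential (sorted_inversions _ s_s) c1.
have -> : size (u ++ [:: fib 1; fib a.+1] ++ v) = size (u ++ [:: x; x] ++ v).
  by rewrite !size_cat.
move: (number_of 1 _) (number_of 2 _) (size _) (inversions _) (count _ _)
  ones large twos inv_t => c1' c2 m I d ones large twos inv_t {c1}.
(* A is V - 2M, where V = 2 m - c1' *)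
set A := 2 * m - c1' - 2 * K.+1.
have -> : 2 * m - c1'.+1 - 2 * K.+1 = A.-1 by lia.
have : A <= 2 * I + 2 by lia.
case: A => [|A] /=; nia.
Qed.

(** For i > 3 both new entries exceed F_1, so that V and c_1 are unchanged. *)
Lemma potential_split_large K u v i :
  3 < i -> sorted leq (u ++ [:: fib i; fib i] ++ v) ->
  potential K (u ++ [:: fib i; fib i] ++ v)
    <= potential K (u ++ [:: fib (i - 2); fib i.+1] ++ v).
Proof.
move=> i_gt3 s_s; rewrite /potential (sorted_inversions _ s_s).
have -> : number_of 1 (u ++ [:: fib (i - 2); fib i.+1] ++ v)
    = number_of 1 (u ++ [:: fib i; fib i] ++ v).
  by rewrite !number_of2; lia.
by rewrite !size_cat /=; lia.
Qed.

(** Once there are at most one F_1 and one F_2, the weight has fallen below 2M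
and nothing remains to be paid.  This covers the merges F_i, F_(i+1) and the
final state. *)
Lemma potential_all_distinct K s :
  sorted leq s -> number_of 1 s <= 1 -> number_of 2 s <= 1 ->
  size s < number_of 1 s + number_of 2 s + K -> potential K s <= 1.
Proof.
move=> s_s le1 le2 large; rewrite /potential (sorted_inversions _ s_s).
have -> : 2 * size s - number_of 1 s - 2 * K.+1 = 0 by lia.
by case: (number_of 1 s) le1 => [|[]].
Qed.

(** * Moves of the strategy *)

Definition lgs_invariant (n : nat) (s : state) : Prop :=
  [/\ fib_entries s, sumn s = n & sparse s].

Lemma leq_sumn (s : seq nat) x : x \in s -> x <= sumn s.
Proof.
elim: s => //= y s IHs; rewrite inE => /orP[/eqP->|/IHs]; lia.
Qed.

(** The sum of the entries is [n] throughout, which bounds their indices. *)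
Lemma size_bound n K s : 1 < K -> (forall i, 0 < i -> fib i <= n -> i <= K) ->
  lgs_invariant n s -> size s < number_of 1 s + number_of 2 s + K.
Proof.
move=> K_gt1 leK [fs sum_s sp]; rewrite size_by_value //.
rewrite ltn_add2l; apply: count_large_le => // i i_gt0 /leq_sumn.
by rewrite sum_s; exact: leK.
Qed.

Lemma fib_entries_replace u w w' v : fib_entries (u ++ w ++ v) ->
  fib_entries w' -> fib_entries (u ++ w' ++ v).
Proof.
move=> fs fw' x; rewrite !mem_cat => /or3P[x_u|/fw' //|x_v].
  by apply: fs; rewrite mem_cat x_u.
by apply: fs; rewrite !mem_cat x_v !orbT.
Qed.

Lemma fib_entries1 a : 0 < a -> fib_entries [:: fib a].
Proof. by move=> a_gt0 x; rewrite inE => /eqP->; exists a. Qed.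

Lemma fib_entries2 a b : 0 < a -> 0 < b -> fib_entries [:: fib a; fib b].
Proof.
by move=> a0 b0 x; rewrite !inE => /orP[]/eqP->; [exists a|exists b].
Qed.

Lemma sorted_cat_cons (u v : seq nat) x : sorted leq (u ++ x :: v) ->
  (forall y, y \in u -> y <= x) /\ (forall y, y \in v -> x <= y).
Proof.
rewrite sorted_pairwise; last exact: leq_trans.
rewrite pairwise_cat /= => /and3P[/allrelP le_u _ /andP[/allP le_v _]].
by split=> // y y_u; apply: le_u => //; exact: mem_head.
Qed.

Lemma sumn_cat_pair u x y v :
  sumn (u ++ [:: x; y] ++ v) = sumn u + x + y + sumn v.
Proof. by rewrite !sumn_cat /=; lia. Qed.

Lemma sub_count_twos u : number_of 2 u <= count (ltn (fib 1)) u.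
Proof. by apply: sub_count => x /= /eqP ->. Qed.

(** The bonus 4 stands for the move itself in a potential scaled by 4.  A switch
uses it up by removing an inversion; the other moves are paid for as explained
at the corresponding potential lemmas. *)
Lemma lgs_step n K s t : 1 < K -> (forall i, 0 < i -> fib i <= n -> i <= K) ->
  lgs_invariant n s -> lgs_move s t ->
  lgs_invariant n t /\ potential K s <= potential K t + 4.
Proof.
move=> K_gt1 leK inv_s; have large := size_bound _ _ _ K_gt1 leK inv_s.
case: inv_s => fs sum_s sp [].
- case=> _ [u [v [x [y [w [_ Es sw ->]]]]]]; subst s.
  case: sw fs sum_s sp {large} => {x y w} i j j_gt0 lt_ji fs sum_s sp.
  have number_t k : number_of k (u ++ [:: fib j; fib i] ++ v)
      = number_of k (u ++ [:: fib i; fib j] ++ v).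
    by rewrite /number_of !count_cat_pair; lia.
  split.
    split; first by apply: fib_entries_replace fs _; apply: fib_entries2; lia.
      by rewrite -sum_s !sumn_cat /=; lia.
    move=> k k_gt2; have [le2 sp_k] := sp k k_gt2.
    by split=> [|l]; rewrite !number_t //; exact: sp_k.
  rewrite /potential inversions_switch; last exact: ltn_fib.
  by rewrite number_t !size_cat /=; lia.
- case=> nsw [_ [u [v [x [y [w [<- Es mo ->]]]]]]]; subst s.
  have s_s := no_switch_sorted _ fs nsw.
  case: mo fs sum_s sp s_s {nsw large} => {x y w} fs sum_s sp s_s left_u.
  have u0 := leftmost_ones _ _ fs s_s left_u; subst u.
  split.
    split; first by apply: (fib_entries_replace [::]) fs _; apply: fib_entries1.
      by rewrite -sum_s.
    exact: (sparse_merge_ones [::]).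
  apply: (potential_merge_ones K v) => // x x_v.
  by apply: fs; rewrite !mem_cat x_v !orbT.
- case=> nsw no_ones [_ [u [v [x [y [w [<- Es spl ->]]]]]]] right_u; subst s.
  have s_s := no_switch_sorted _ fs nsw.
  have ones : number_of 1 (u ++ [:: x; y] ++ v) <= 1.
    by rewrite leqNgt; apply/negP => /(available_merge_ones _ s_s).
  case: spl {nsw no_ones} => [[{x y w} i i_gt2]|[{x y w}]] in fs sum_s sp large s_s ones right_u *.
    split.
      split; first by apply: fib_entries_replace fs _; apply: fib_entries2; lia.
        by rewrite -sum_s !sumn_cat_pair; have := fib_split _ i_gt2; lia.
      exact: sparse_split.
    have [i_gt3|i_le3] := ltnP 3 i.
      by apply: leq_trans (leq_addr _ _); exact: potential_split_large.
    (* all the twos lie to the left of the pair, so the new F_1 crosses them *)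
    have i3 : i = 3 by lia.
    subst i; apply: potential_split => //.
    have v2 : number_of 2 v = 0.
      apply/eqP; rewrite -leqn0 leqNgt -has_count has_pred1; apply/negP => v2.
      by have [_ /(_ (fib 2))] := sorted_cat_cons _ _ _ s_s; rewrite inE v2 orbT => /(_ isT).
    have u2 : number_of 2 u <= count (ltn (fib 1)) u by exact: sub_count_twos.
    by rewrite number_of2 ?v2; lia.
  have le1 j : 1 < j -> number_of j (fib 2 :: v) <= 1.
    by move=> j_gt1; apply: (rightmost_split u v 2) right_u.
  split.
    split; first by apply: fib_entries_replace fs _; apply: fib_entries2; lia.
      by rewrite -sum_s !sumn_cat.
    apply: sparse_split_twos => i i_gt2.
    have u_i : number_of i u = 0.
      apply/eqP; rewrite -leqn0 leqNgt -has_count has_pred1; apply/negP => u_i.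
      have [/(_ _ u_i) + _] := sorted_cat_cons _ _ _ s_s.
      by have := ltn_fib 2 i isT i_gt2; lia.
    have := le1 i (ltnW i_gt2); rewrite number_of2 ?u_i /number_of /=; lia.
  apply: potential_split => //.
  have u2 : number_of 2 u <= count (ltn (fib 1)) u by exact: sub_count_twos.
  have := le1 2 isT; rewrite number_of2 // /number_of /= in u2 *; lia.
case=> nsw no_ones no_split [_ [u [v [x [y [w [<- Es mg ->]]]]]]] _; subst s.
have s_s := no_switch_sorted _ fs nsw.
have ones : number_of 1 (u ++ [:: x; y] ++ v) <= 1.
  by rewrite leqNgt; apply/negP => /(available_merge_ones _ s_s).
have others j : 1 < j -> number_of j (u ++ [:: x; y] ++ v) <= 1.
  by move=> j_gt1; rewrite leqNgt; apply/negP => /(available_any_split _ _ s_s j_gt1).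
split; last first.
  by have := potential_all_distinct K _ s_s ones (others 2 isT) large; lia.
case: mg {nsw no_ones no_split} => {x y w} i i_gt0 in fs sum_s sp large s_s ones others *.
split; first by apply: fib_entries_replace fs _; apply: fib_entries1.
  by rewrite -sum_s sumn_cat_pair !sumn_cat [sumn [:: _]]addn0 fibSS; lia.
by apply: sparse_merge => // j j_gt2; apply: others; lia.
Qed.

Lemma lgs_plays n K s p : 1 < K -> (forall i, 0 < i -> fib i <= n -> i <= K) ->
  lgs_invariant n s -> plays lgs_move s p ->
  lgs_invariant n (last s p) /\
    potential K s <= potential K (last s p) + 4 * size p.
Proof.
move=> K_gt1 leK; elim: p s => [|t p IHp] s inv_s /=; first by rewrite muln0 addn0.
case=> /(lgs_step _ _ _ _ K_gt1 leK inv_s)[inv_t le_st] /(IHp _ inv_t)[inv_l le_tl].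
by split=> //; lia.
Qed.

Lemma game_over_potential n K s : 1 < K ->
  (forall i, 0 < i -> fib i <= n -> i <= K) ->
  lgs_invariant n s -> game_over s -> potential K s <= 1.
Proof.
move=> K_gt1 leK inv_s over; have large := size_bound _ _ _ K_gt1 leK inv_s.
have none (r : rule) : (forall x y w, r x y w -> legal_rule x y w) -> ~ available r s.
  move=> r_legal [k [t [u [v [x [y [w [uk Es rw Et]]]]]]]]; apply: over.
  by exists k, t, u, v, x, y, w; split=> //; exact: r_legal.
have [fs _ _] := inv_s.
have s_s : sorted leq s.
  by apply: no_switch_sorted fs (none _ _) => x y w; apply: Or44.
apply: potential_all_distinct => //; rewrite leqNgt; apply/negP.
  by move/(available_merge_ones _ s_s); apply: none => x y w; apply: Or42.
by move/(available_any_split _ 2 s_s isT); apply: none => x y w; apply: Or43.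
Qed.

Lemma lgs_play_size n K p : 1 < K ->
  (forall i, 0 < i -> fib i <= n -> i <= K) -> lgs_play n p ->
  n ^ 2 + (n - 2 * K.+1) ^ 2 <= 4 * size p + 1.
Proof.
move=> K_gt1 leK [pl over].
have number_init i : 0 < i -> number_of i (initial_state n) = (i == 1) * n.
  by move=> i_gt0; rewrite /number_of count_nseq /= (eq_fib 1) // eq_sym.
have inv_init : lgs_invariant n (initial_state n).
  split=> [x /nseqP[-> _]||i i_gt2]; first by exists 1.
    by rewrite /initial_state sumn_nseq mul1n.
  by rewrite number_init; [split=> [|j]; lia|lia].
have [inv_l] := lgs_plays _ _ _ _ K_gt1 leK inv_init pl.
have := game_over_potential _ _ _ K_gt1 leK inv_l over.
have : n ^ 2 + (n - 2 * K.+1) ^ 2 <= potential K (initial_state n).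
  rewrite /potential number_init // mul1n size_nseq.
  by rewrite [2 * n]mul2n -addnn addnK -addnA leq_addl.
by lia.
Qed.

Lemma largest_fib_index n : 1 < n -> exists K,
  [/\ 1 < K, fib K <= n & forall i, 0 < i -> fib i <= n -> i <= K].
Proof.
move=> n_gt1; have ex : exists i, fib i <= n by exists 2.
have bound i : fib i <= n -> i <= n by apply: leq_trans; exact: leq_fib_index.
case: (ex_maxnP ex bound) => K fibK maxK.
by exists K; split=> [||i _]; [exact: maxK| |exact: maxK].
Qed.

Local Open Scope ring_scope.

(** * Asymptotics *)

Lemma golden_ratio_gt1 (R : realType) : 1 < golden_ratio R.
Proof.
rewrite /golden_ratio; have : 1 < Num.sqrt (5%:R : R).
  by rewrite -[ltLHS]sqrtr1 ltr_sqrt ?ltr_nat // ltr1n.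
by lra.
Qed.

Lemma golden_ratio_sqr (R : realType) :
  golden_ratio R ^+ 2 = golden_ratio R + 1.
Proof.
rewrite /golden_ratio; have : Num.sqrt (5%:R : R) ^+ 2 = 5%:R by rewrite sqr_sqrtr.
by move: (Num.sqrt _) => x; lra.
Qed.

Lemma golden_ratio_expn_le_fib (R : realType) i :
  golden_ratio R ^+ i <= (fib i.+1)%:R.
Proof.
have phi_gt1 := golden_ratio_gt1 R.
suff [] : golden_ratio R ^+ i <= (fib i.+1)%:R /\
          golden_ratio R ^+ i.+1 <= (fib i.+2)%:R by [].
elim: i => [|i [IH1 IH2]].
  rewrite expr0 expr1; split=> //=.
  have : golden_ratio R ^+ 2 = golden_ratio R + 1 := golden_ratio_sqr R.
  by move: (golden_ratio R) phi_gt1 => x; nra.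
split=> //; rewrite fibSS natrD.
have -> : golden_ratio R ^+ i.+2 = golden_ratio R ^+ i.+1 + golden_ratio R ^+ i.
  by rewrite -addn2 exprD golden_ratio_sqr exprS; ring.
exact: lerD.
Qed.

(** F_K >= phi^(K-1), so indices of Fibonacci numbers up to n exceed log_phi n
by at most 1. *)
Lemma fib_index_le_log (R : realType) (K n : nat) : (1 < K)%N -> (fib K <= n)%N ->
  K%:R <= log_phi (n%:R : R) + 1.
Proof.
case: K => // K _ leKn; have phi_gt1 := golden_ratio_gt1 R.
have lnphi_gt0 : 0 < ln (golden_ratio R) by exact: ln_gt0.
have phi_gt0 : 0 < golden_ratio R by lra.
rewrite -natr1 lerD2r /log_phi ler_pdivlMr // mulrC mulr_natr -lnXn //.
have le_phi_n : golden_ratio R ^+ K <= n%:R.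
  by apply: le_trans (golden_ratio_expn_le_fib R K) _; rewrite ler_nat.
rewrite ler_ln // posrE ?exprn_gt0 //.
by apply: lt_le_trans le_phi_n; rewrite exprn_gt0.
Qed.

Lemma log_phi_cvgy (R : realType) : log_phi (n%:R : R) @[n --> \oo] --> +oo.
Proof.
apply/cvgryPge => A; have lnphi_gt0 := ln_gt0 (golden_ratio_gt1 R).
have /cvgryPge/(_ (expR (A * ln (golden_ratio R)))) := @cvgr_idn R.
apply: filterS => n le_n; rewrite /log_phi ler_pdivlMr //.
rewrite -[leLHS]expRK ler_ln // posrE ?expR_gt0 //.
exact: lt_le_trans (expR_gt0 _) le_n.
Qed.

Lemma linear_over_nlog (R : realType) (c : R) :
  c * n%:R / (n%:R * log_phi n%:R) @[n --> \oo] --> (0 : R).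
Proof.
have log_y := log_phi_cvgy R.
have logV : (log_phi (n%:R : R))^-1 @[n --> \oo] --> (0 : R).
  by apply/gtr0_cvgV0 => //; move/cvgryPgt : log_y => /(_ 0).
rewrite -[X in _ --> X](mulr0 c).
apply: cvg_trans (cvgM (cvg_cst c) logV).
apply: near_eq_cvg; near=> n.
have n_gt0 : 0 < n%:R :> R by rewrite ltr0n; near: n; exact: nbhs_infty_gt.
by rewrite /= [n%:R * _]mulrC -mulf_div divff ?mulr1 ?gt_eqF.
Unshelve. all: by end_near. Qed.

Theorem theorem1p10 (R : realType) :
  exists e : nat -> R,
    (e n / (n%:R * log_phi n%:R) @[n --> \oo] --> (0 : R)) /\
    (forall (n : nat) (p : seq state), (2 <= n)%N -> lgs_play n p ->
       n%:R ^+ 2 / 2%:R - n%:R * log_phi n%:R + e n <= (size p)%:R).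
Proof.
(* With M = K + 1 <= log_phi n + 2 the length is at least
   n^2 / 2 - n (log_phi n + 2) - 1 / 4, and 2 n + 1 / 4 <= 3 n. *)
exists (fun n => -3%:R * n%:R); split; first exact: linear_over_nlog.
move=> n p n_gt1.
have [K [K_gt1 leKn maxK]] := largest_fib_index _ n_gt1.
move/(lgs_play_size _ _ _ K_gt1 maxK) => le_size.
have leK_log := fib_index_le_log R _ _ K_gt1 leKn.
have {}le_size : (n%:R ^+ 2 + (n%:R ^+ 2 - 4 * n%:R * K.+1%:R) <= 4 * (size p)%:R + 1 :> R).
  (* where the truncated difference is 0, n^2 <= 4 n M holds anyway *)
  apply: (@le_trans _ _ (n ^ 2 + (n - 2 * K.+1) ^ 2)%:R); last first.
    by rewrite -natrM -[1]/(1%:R) -natrD ler_nat.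
  rewrite natrD !natrX lerD2l.
  have [le_2K|lt_2K] := leqP (2 * K.+1) n.
    by rewrite natrB // natrM; move: (n%:R) (K.+1%:R) => a b; nra.
  rewrite (eqP (ltnW lt_2K)) expr0n /=.
  have : (n%:R <= 2 * K.+1%:R :> R) by rewrite -natrM ler_nat ltnW.
  have : (0 <= n%:R :> R) by [].
  by move: (n%:R) (K.+1%:R) => a b; nra.
have n_ge1 : (1 <= n%:R :> R) by rewrite ler1n ltnW.
rewrite -natr1 in le_size.
have := ler_wpM2l (le_trans ler01 n_ge1) leK_log.
by lra.
Qed.
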